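(* Let $\alpha\in\mathbb{R}$ with $\alpha-\max G\neq 0,-1,-2,\ldots$, and assume that $\Omega_G(n)\neq 0$ for $n=0,1,2,\ldots$. Then the polynomials $(q_n)_n$ never satisfy a three-term recurrence relation $$xq_n(x)=a_nq_{n+1}(x)+b_nq_n(x)+c_nq_{n-1}(x),\qquad n\ge 0,$$ with $(a_n)_n,(b_n)_n,(c_n)_n$ sequences of real numbers with $c_n\neq0$ for $n\ge1$; hence they are not orthogonal with respect to any measure.
   Context: For $\alpha\in\mathbb{R}$ the Laguerre polynomials are $L_n^{\alpha}(x)=\sum_{j=0}^n\frac{(-x)^j}{j!}\binom{n+\alpha}{n-j}$ for $n\ge 0$, and $L_n^\alpha=0$ for $n<0$ (here $\binom{y}{k}=y(y-1)\cdots(y-k+1)/k!$). $G=\{g_1<g_2<\cdots<g_m\}$ is a finite set of $m\ge 1$ positive integers and, for each $g\in G$, $\mathcal{R}_g$ is a real polynomial of degree $g$ with leading coefficient $1/g!$. Put $\Omega_G(x)=\det\left(\mathcal{R}_{g_l}(x-j)\right)_{l,j=1}^m$. The polynomials $(q_n)_{n\ge 0}$ are defined by $$q_n(x)=\begin{vmatrix} L^\alpha_n(x) & L^\alpha_{n-1}(x) & \cdots & L^\alpha_{n-m}(x)\\ \mathcal{R}_{g_1}(n)&\mathcal{R}_{g_1}(n-1)&\cdots&\mathcal{R}_{g_1}(n-m)\\ \vdots&\vdots&\ddots&\vdots\\ \mathcal{R}_{g_m}(n)&\mathcal{R}_{g_m}(n-1)&\cdots&\mathcal{R}_{g_m}(n-m)\end{vmatrix},$$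 with $q_{-1}=0$. ''Orthogonal with respect to a measure'' means with respect to a (not necessarily positive) measure $\mu$ on the real line: $\int q_nq_k\,d\mu=0$ for $n\ne k$ and $\int q_n^2\,d\mu\neq0$ for all $n\ge0$. (By Favard's theorem this is equivalent to a three-term recurrence of the form $xq_n(x)=a_nq_{n+1}(x)+b_nq_n(x)+c_nq_{n-1}(x)$, $n\ge 0$, with $(a_n)_n,(b_n)_n,(c_n)_n$ sequences of real numbers with $c_n\neq0$ for $n\ge1$.) *)

(* Defs.v *)
From mathcomp Require Import all_boot all_order all_algebra.
From mathcomp Require Import all_classical all_reals all_analysis.

Set Implicit Arguments.
Unset Strict Implicit.
Unset Printing Implicit Defensive.

Import Order.TTheory GRing.Theory Num.Theory.

Local Open Scope classical_set_scope.
Local Open Scope ring_scope.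

Definition gbinom (R : realType) (y : R) (k : nat) : R :=
  (\prod_(i < k) (y - i%:R)) / k`!%:R.

Definition laguerre (R : realType) (alpha : R) (z : int) : {poly R} :=
  match z with
  | Posz n =>
      \sum_(j < n.+1) (gbinom (n%:R + alpha) (n - j) / j`!%:R) *: (- 'X) ^+ j
  | Negz _ => 0
  end.

(* A finite set g_1 < ... < g_m is encoded by the strictly increasing sequence
   of its elements, so that m = size G and g_l = nth 0 G l.-1.  The family
   (R_g) is a function on nat of which only the values at g \in G are used. *)

Definition OmegaG (R : realType) (G : seq nat) (Rg : nat -> {poly R}) (x : R)
    : R :=
  \det (\matrix_(l < size G, j < size G) (Rg (nth 0%N G l)).[x - j.+1%:R]).

Definition laguerre_casorati (R : realType) (alpha : R) (G : seq nat)
    (Rg : nat -> {poly R}) (n : nat) : {poly R} :=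
  \det (\matrix_(i < (size G).+1, j < (size G).+1)
          match val i with
          | 0%N => laguerre alpha (n%:Z - j%:Z)
          | l.+1 => ((Rg (nth 0%N G l)).[n%:R - j%:R])%:P
          end).

Definition three_term_recurrence (R : realType) (q : nat -> {poly R})
    (a b c : nat -> R) : Prop :=
  forall n : nat,
    'X * q n = a n *: q n.+1 + b n *: q n
               + c n *: (if n is k.+1 then q k else 0).

Definition charge_integrable (R : realType)
    (nu : {charge set (measurableTypeR R) -> \bar R})
    (P N : set (measurableTypeR R)) (nuPN : hahn_decomposition nu P N)
    (f : R -> R) : Prop :=
  (jordan_pos nuPN).-integrable setT (EFin \o f) /\
  (jordan_neg nuPN).-integrable setT (EFin \o f).

Definition charge_integral (R : realType)
    (nu : {charge set (measurableTypeR R) -> \bar R})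
    (P N : set (measurableTypeR R)) (nuPN : hahn_decomposition nu P N)
    (f : R -> R) : R :=
  \int[jordan_pos nuPN]_(x in setT) f x - \int[jordan_neg nuPN]_(x in setT) f x.

(* The Jordan parts do not depend on the Hahn decomposition (P, N), so the
   existential is just a choice of representative.  Charges are finite signed
   measures; this is no restriction when q 0 is a nonzero constant, since
   integrability of q 0 ^+ 2 then forces the total variation to be finite. *)
Definition orthogonal_wrt (R : realType) (q : nat -> {poly R})
    (nu : {charge set (measurableTypeR R) -> \bar R}) : Prop :=
  exists (P N : set (measurableTypeR R)) (nuPN : hahn_decomposition nu P N),
    [/\ forall n k : nat,
          charge_integrable nuPN (fun x => (q n).[x] * (q k).[x]),
        forall n k : nat, n <> k ->
          charge_integral nuPN (fun x => (q n).[x] * (q k).[x]) = 0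
      & forall n : nat,
          charge_integral nuPN (fun x => (q n).[x] ^+ 2) <> 0].

(* Main.v *)
From HB Require Import structures.
Require Import Defs.
From mathcomp Require Import all_boot all_order all_algebra.
From mathcomp Require Import all_classical all_reals all_analysis.
From mathcomp Require Import ring zify.

Set Implicit Arguments.
Unset Strict Implicit.
Unset Printing Implicit Defensive.

Import Order.TTheory GRing.Theory Num.Theory.

Local Open Scope classical_set_scope.
Local Open Scope ring_scope.

(** Let [m = size G] and let [W] be the span of the polynomials [Rg g], [g \in G].
    Expanding along the first row, q_n = \sum_(j <= m) beta_{n,j} L_{n-j}, and the
    difference operator [T] with coefficients beta_{n,j} is a Casorati
    determinant: T y (n) = 0 exactly says that the row y(n), ..., y(n-m) is a
    combination of the corresponding rows of the [Rg g].  Since beta_{n,0} is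
    Omega_G(n), which never vanishes, [T] has no polynomials in its kernel other
    than those of [W] ([casorati_kernel_poly]).

    Suppose that the q_n satisfy a three-term recurrence.  The Laguerre
    polynomials form a basis, so for every polynomial [p] there is a linear
    functional sending L_k to p(k) ([graded_dual]).  For [p] in [W] it sends q_n to
    T p (n) = 0 as soon as n >= m, hence it also kills 'X * q_n when n > m.  The
    three-term recurrence of the L_k turns multiplication by 'X into the operator
      (J p)(x) = - (x + 1) p(x + 1) + (2 x + alpha + 1) p(x) - (x + alpha) p(x - 1),
    so T (J p) (n) = 0 for n > m ([recurrence_casorati_dual]): [W] is stable by
    [J].

    In terms of differences, J = (x + 1) D_1 D_{-1} - (alpha - 1) D_{-1}; on a
    polynomial of degree g > 0 it lowers the degree by exactly one unless
    alpha = g ([laguerre_dual_top]), which the hypothesis on alpha - max G excludes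
    for [g \in G].  Apply this to the element of smallest degree g_1 of the family:
    J p would be a nonzero element of [W] of degree g_1 - 1, whereas every nonzero
    element of [W] has its degree in [G].

    As to measures, Omega_G(n) <> 0 gives q_n degree [n], and integration against
    the charge is a linear functional on all polynomials; the easy half of
    Favard's theorem ([orthogonal_three_term]) then yields a three-term
    recurrence, so the second claim reduces to the first. *)

(** * Polynomials of consecutive degrees *)

Lemma size_split_top (F : fieldType) (q p : {poly F}) (n : nat) :
  size q = n.+1 -> (size p <= n.+1)%N ->
  (size (p - (p`_n / lead_coef q) *: q)%R <= n)%N.
Proof.
move=> sq sp; have lq : lead_coef q != 0 by rewrite lead_coef_eq0 -size_poly_eq0 sq.
have lqE : q`_n = lead_coef q by rewrite lead_coefE sq.
apply/leq_sizeP => j; rewrite leq_eqVlt => /predU1P[<-|nj].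
  by rewrite coefB coefZ lqE divfK ?subrr.
by rewrite coefB coefZ !(nth_default _ (leq_trans _ nj)) ?mulr0 ?subr0 ?sq.
Qed.

(** Induction on the filtration by degree, along a basis with one polynomial in
    each degree; the bound [n] is part of the property so that it can say
    something about the [q k] with [n <= k]. *)
Lemma graded_ind (F : fieldType) (q : nat -> {poly F}) (P : nat -> {poly F} -> Prop) :
  (forall n, size (q n) = n.+1) -> P 0%N 0 ->
  (forall n (p : {poly F}) c, P n p -> P n.+1 (p + c *: q n)) ->
  forall n (p : {poly F}), (size p <= n)%N -> P n p.
Proof.
move=> sq P0 PS; elim=> [p|n IHn p sp].
  by rewrite leqn0 size_poly_eq0 => /eqP ->.
rewrite -[p](subrK ((p`_n / lead_coef (q n)) *: q n)).
by apply/PS/IHn/size_split_top.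
Qed.

(** A graded family is a basis, so a functional can be prescribed on it.  Peeling
    off the top coefficient defines it one degree at a time. *)
Lemma graded_dual (F : fieldType) (q : nat -> {poly F}) (y : nat -> F) :
  (forall n, size (q n) = n.+1) ->
  forall N, exists f : {scalar {poly F}}, forall k, (k < N)%N -> f (q k) = y k.
Proof.
move=> sq; elim=> [|N [f fE]].
  by exists (GRing.Linear.clone _ _ _ _ \0 _).
pose t (p : {poly F}) := p`_N / lead_coef (q N).
pose g (p : {poly F}) : F := t p * y N + f (p - t p *: q N).
have g_lin : linear_for *%R g.
  move=> a u v; rewrite /g.
  have -> : t (a *: u + v) = a * t u + t v.
    by rewrite /t coefD coefZ mulrDl mulrA.
  have -> : a *: u + v - (a * t u + t v) *: q N =
            a *: (u - t u *: q N) + (v - t v *: q N).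
    by rewrite scalerDl scalerBr scalerA opprD addrACA.
  by rewrite linearP; ring.
pose gl := GRing.isLinear.Build F {poly F} F *%R g g_lin.
pose G : {scalar {poly F}} := HB.pack g gl.
exists G => k; rewrite ltnS leq_eqVlt /= /g => /predU1P[->|kN].
  have -> : t (q N) = 1.
    rewrite /t lead_coefE sq divff // -[N in _`_N]/(N.+1.-1) -sq -lead_coefE.
    by rewrite lead_coef_eq0 -size_poly_eq0 sq.
  by rewrite scale1r subrr linear0 mul1r addr0.
by rewrite /t nth_default ?sq // mul0r mul0r add0r scale0r subr0 fE.
Qed.

(** * Lowering the degree by second-order differences *)

Definition shift_diff (F : comNzRingType) (h : F) (p : {poly F}) : {poly F} :=
  p \Po ('X + h%:P) - p.

(** The difference acts on top coefficients as [h] times the derivative: writing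
    the polynomial as p * 'X + c, it obeys a Leibniz rule that makes the
    statement inductive.  The bound [n.+1] on the size need not be sharp, so that
    the lemma can be iterated. *)
Lemma shift_diff_top (F : comNzRingType) (h : F) (p : {poly F}) (n : nat) :
  (size p <= n.+1)%N ->
  (size (shift_diff h p) <= n)%N /\ (shift_diff h p)`_n.-1 = n%:R * h * p`_n.
Proof.
elim/poly_ind: p n => [|p c IHp] n sp.
  by rewrite /shift_diff comp_poly0 subr0 size_poly0 !coef0 mulr0.
have sp' : (size p <= n)%N.
  apply/leq_sizeP => j nj.
  have /leq_sizeP/(_ j.+1) := sp.
  by rewrite coefD coefMX coefC /= addr0; apply.
have -> : shift_diff h (p * 'X + c%:P) =
    shift_diff h p * 'X + h *: shift_diff h p + h *: p.
  rewrite /shift_diff comp_polyD comp_polyM comp_polyX comp_polyC -!mul_polyC.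
  ring.
case: n sp' sp => [|n] sp' sp.
  have -> : p = 0 by apply/eqP; rewrite -size_poly_eq0 -leqn0.
  by rewrite /shift_diff comp_poly0 subr0 mul0r !scaler0 !addr0 size_poly0 coef0 !mul0r.
have [sd cd] := IHp n sp'; split.
  apply/leq_sizeP => j nj; rewrite !coefD !coefZ coefMX.
  rewrite (nth_default _ (leq_trans sp' nj)) (nth_default _ (leq_trans sd (ltnW nj))).
  by case: j nj => //= j nj; rewrite nth_default ?(leq_trans sd) ?mulr0 ?addr0.
rewrite /= !coefD !coefZ coefMX coefC /= addr0 coefMX /=.
rewrite (nth_default _ sd) mulr0 addr0.
by case: n {IHp sp sp' sd} cd => [|n] /= cd; rewrite ?cd -?[n.+2]addn1 ?natrD; ring.
Qed.

(** The operator by which multiplication by 'X acts on the index of the Laguerre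
    polynomials, in the form that shows its effect on degrees;
    [laguerre_dual_eval] gives the three-point form. *)
Definition laguerre_dual (F : comNzRingType) (alpha : F) (p : {poly F}) : {poly F} :=
  ('X + 1) * shift_diff 1 (shift_diff (-1) p) - (alpha - 1) *: shift_diff (-1) p.

Lemma laguerre_dual_eval (F : comNzRingType) (alpha x : F) (p : {poly F}) :
  (laguerre_dual alpha p).[x] = - (x + 1) * p.[x + 1]
    + (2 * x + alpha + 1) * p.[x] - (x + alpha) * p.[x - 1].
Proof.
rewrite /laguerre_dual /shift_diff !(hornerE, horner_comp) /= addrK.
ring.
Qed.

(** The two terms contribute - g (g + 1) and (alpha - 1)(g + 1) times the old top
    coefficient to the new one, hence the factor that vanishes only for alpha = g + 1. *)
Lemma laguerre_dual_top (F : comNzRingType) (alpha : F) (p : {poly F}) (g : nat) :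
  (size p <= g.+2)%N ->
  (size (laguerre_dual alpha p) <= g.+1)%N /\
  (laguerre_dual alpha p)`_g = g.+1%:R * (alpha - g.+1%:R) * p`_g.+1.
Proof.
move=> sp; have [s1 c1] := shift_diff_top (-1) sp.
have [s2 c2] := shift_diff_top 1 s1; rewrite /= in c1 c2.
rewrite /laguerre_dual mulrDl mul1r; split.
  apply/leq_sizeP => j gj; rewrite coefB coefZ coefD coefXM.
  rewrite (nth_default _ (leq_trans s1 gj)) (nth_default _ (leq_trans s2 (ltnW gj))).
  by case: j gj => //= j gj; rewrite nth_default ?(leq_trans s2) ?mulr0 ?addr0 ?subr0.
rewrite coefB coefZ coefD coefXM (nth_default _ s2) c1.
have -> : (if g == 0%N then 0 else (shift_diff 1 (shift_diff (-1) p))`_g.-1) =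
   g%:R * (g.+1%:R * -1 * p`_g.+1).
  by case: g {sp s1 s2} c1 c2 => [|g] c1 c2 /=; rewrite ?mul0r // c2 c1 mulr1.
by rewrite -[g.+1]addn1 natrD; ring.
Qed.

(** * The Laguerre polynomials *)

Lemma gbinom0 (R : realType) (y : R) : gbinom y 0 = 1.
Proof. by rewrite /gbinom big_ord0 fact0 divr1. Qed.

Lemma gbinomS (R : realType) (y : R) k :
  k.+1%:R * gbinom y k.+1 = (y - k%:R) * gbinom y k.
Proof.
rewrite /gbinom big_ord_recr /= factS natrM.
have k0 : k.+1%:R != 0 :> R by rewrite pnatr_eq0.
have kf : k`!%:R != 0 :> R by rewrite pnatr_eq0 -lt0n fact_gt0.
by move: k.+1%:R k0 => a a0; field; rewrite a0 kf.
Qed.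

Lemma gbinomS_absorb (R : realType) (y : R) k :
  k.+1%:R * gbinom y k.+1 = y * gbinom (y - 1) k.
Proof.
rewrite /gbinom big_ord_recl /= factS natrM subr0.
have k0 : k.+1%:R != 0 :> R by rewrite pnatr_eq0.
have kf : k`!%:R != 0 :> R by rewrite pnatr_eq0 -lt0n fact_gt0.
rewrite (eq_bigr (fun i : 'I_k => y - 1 - i%:R)) => [|i _].
  by move: k.+1%:R k0 => a a0; field; rewrite a0 kf.
by rewrite /bump /= add1n -[i.+1]addn1 natrD; ring.
Qed.

Lemma gbinom_pascal (R : realType) (y : R) k :
  gbinom (y + 1) k.+1 = gbinom y k.+1 + gbinom y k.
Proof.
have k0 : k.+1%:R != 0 :> R by rewrite pnatr_eq0.
apply: (mulfI k0); rewrite gbinomS_absorb addrK mulrDr gbinomS -[k.+1]addn1 natrD.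
by ring.
Qed.

Lemma coef_laguerre (R : realType) (alpha : R) (n i : nat) :
  (laguerre alpha n)`_i =
  if (i <= n)%N then (-1) ^+ i / i`!%:R * gbinom (n%:R + alpha) (n - i) else 0.
Proof.
have -> : laguerre alpha n =
    \poly_(j < n.+1) ((-1) ^+ j / j`!%:R * gbinom (n%:R + alpha) (n - j)).
  rewrite poly_def; apply: eq_bigr => j _.
  by rewrite -scaleN1r exprZn scalerA; congr (_ *: _); ring.
by rewrite coef_poly ltnS.
Qed.

Lemma size_laguerre (R : realType) (alpha : R) (n : nat) :
  size (laguerre alpha n) = n.+1.
Proof.
apply/eqP; rewrite eqn_leq; apply/andP; split.
  by apply/leq_sizeP => j nj; rewrite coef_laguerre leqNgt nj.
rewrite ltnNge; apply/negP => /leq_sizeP/(_ n (leqnn n))/eqP.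
rewrite coef_laguerre leqnn subnn gbinom0 mulr1 mulf_eq0 signr_eq0 invr_eq0.
by rewrite pnatr_eq0 eqn0Ngt fact_gt0.
Qed.

(** This is the comparison of coefficients in [laguerre_recurrence], with
    n.+1 = N and n.+1 + alpha = a and freed from signs and factorials. *)
Lemma gbinom_contiguous (R : realType) (N a : R) (d : nat) :
  (N + 1 - d.+2%:R) * gbinom a d.+2 =
  (N + 1) * gbinom (a + 1) d.+2 - (N + 1 + a) * gbinom a d.+1
  + a * gbinom (a - 1) d.
Proof.
rewrite gbinom_pascal -gbinomS_absorb.
have := gbinomS a d.+1; rewrite -[d.+2]addn1 natrD => E.
rewrite mulrBl E; ring.
Qed.

Lemma laguerre_recurrence (R : realType) (alpha : R) (n : nat) :
  'X * laguerre alpha n.+1 =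
    - (n.+2%:R) *: laguerre alpha n.+2
    + (2 * n.+1%:R + alpha + 1) *: laguerre alpha n.+1
    - (n.+1%:R + alpha) *: laguerre alpha n.
Proof.
apply/polyP => i; rewrite coefXM coefB coefD !coefZ.
have [big|le_i] := ltnP n.+2 i.
  case: i big => // i big /=.
  by rewrite !nth_default ?size_laguerre ?mulr0 ?addr0 ?subr0 //; lia.
(* Everything is expressed through d = n.+2 - i, the lower index of the largest
   binomial; the cases d = 0 and d = 1 are those where some of the
   coefficients lie beyond the degree. *)
rewrite !coef_laguerre le_i.
have nE : n.+2%:R + alpha = n.+1%:R + alpha + 1 :> R by rewrite -[n.+2]addn1 natrD; ring.
have nE' : n%:R + alpha = n.+1%:R + alpha - 1 :> R by rewrite -[n.+1]addn1 natrD; ring.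
rewrite nE nE'; set a := n.+1%:R + alpha.
have iE : i%:R = n.+1%:R + 1 - (n.+2 - i)%:R :> R.
  by rewrite natrB // -[n.+2]addn1 natrD; ring.
have signE : (if i == 0%N then 0 else
      if (i.-1 <= n.+1)%N then (-1) ^+ i.-1 / (i.-1)`!%:R * gbinom a (n.+1 - i.-1) else 0)
    = - (i%:R * ((-1) ^+ i / i`!%:R)) * gbinom a (n.+2 - i).
  case: i le_i {iE} => [|i] le_i /=; first by rewrite mul0r oppr0 mul0r.
  rewrite -ltnS le_i subSS exprS factS natrM.
  have i0 : i.+1%:R != 0 :> R by rewrite pnatr_eq0.
  have fi : i`!%:R != 0 :> R by rewrite pnatr_eq0 -lt0n fact_gt0.
  by move: i.+1%:R i0 => b b0; field; rewrite b0 fi.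
rewrite signE; move: ((-1) ^+ i / i`!%:R) => s.
have [d dE] : exists d, (n.+2 - i = d)%N by exists (n.+2 - i)%N.
case: d dE => [|[|d]] dE.
- have -> : (i <= n.+1)%N = false by lia.
  have -> : (i <= n)%N = false by lia.
  by rewrite iE dE !gbinom0 -[n.+2]addn1 natrD; ring.
- have -> : (i <= n.+1)%N by lia.
  have -> : (i <= n)%N = false by lia.
  have -> : (n.+1 - i = 0)%N by lia.
  have gb1 y : gbinom y 1 = y :> R.
    by have := gbinomS y 0; rewrite gbinom0 mul1r subr0 mulr1.
  by rewrite iE dE !gb1 gbinom0 /a -[n.+2]addn1 natrD; ring.
have -> : (i <= n.+1)%N by lia.
have -> : (i <= n)%N by lia.
have -> : (n.+1 - i = d.+1)%N by lia.
have -> : (n - i = d)%N by lia.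
rewrite dE iE dE; have := gbinom_contiguous n.+1%:R a d.
rewrite -[n.+2]addn1 natrD; set u := gbinom a _; set v := gbinom _ d.+2.
move=> E.
have -> : - ((n.+1%:R + 1 - d.+2%:R) * s) * u = - s * ((n.+1%:R + 1 - d.+2%:R) * u) by ring.
by rewrite E /a; ring.
Qed.

(** * Casorati determinants with a free first row *)

(** The coefficients of the difference operator obtained by expanding the
    determinant along its first row.  A cofactor does not see the row it is
    taken at, so that row can be filled with zeros. *)
Definition casorati_minor (R : realType) (G : seq nat) (Rg : nat -> {poly R})
    (n : nat) (j : 'I_(size G).+1) : R :=
  cofactor (\matrix_(i < (size G).+1, k < (size G).+1)
    (if val i is l.+1 then (Rg (nth 0%N G l)).[n%:R - k%:R] else 0)) ord0 j.

Arguments casorati_minor {R} G Rg n j.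

Lemma laguerre_casorati_sum (R : realType) (alpha : R) G (Rg : nat -> {poly R}) n :
  laguerre_casorati alpha G Rg n =
  \sum_(j < (size G).+1) casorati_minor G Rg n j *: laguerre alpha (n%:Z - j%:Z).
Proof.
rewrite /laguerre_casorati (expand_det_row _ ord0); apply: eq_bigr => j _.
rewrite mxE /= -mul_polyC mulrC; congr (_ * _).
rewrite /casorati_minor /cofactor rmorphM rmorphXn rmorphN1 -det_map_mx.
by congr (_ * \det _); apply/matrixP => a b; rewrite !mxE.
Qed.

(** The sum is the determinant whose first row repeats the row of [g]. *)
Lemma casorati_minor_annihilates (R : realType) G (Rg : nat -> {poly R}) n g :
  g \in G -> \sum_(j < (size G).+1) casorati_minor G Rg n j * (Rg g).[n%:R - j%:R] = 0.
Proof.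
move=> gG; have := gG; rewrite -index_mem => lG.
pose A := \matrix_(i < (size G).+1, k < (size G).+1)
  (Rg (nth 0%N G (if val i is l.+1 then l else index g G))).[n%:R - k%:R].
transitivity (\det A).
  rewrite (expand_det_row _ ord0); apply: eq_bigr => j _.
  rewrite mxE /= nth_index // mulrC; congr (_ * _).
  rewrite /casorati_minor /cofactor; congr (_ * \det _).
  by apply/matrixP => a b; rewrite !mxE.
apply: (@determinant_alternate _ _ _ ord0 (lift ord0 (Ordinal lG))) => // j.
by rewrite !mxE.
Qed.

Lemma casorati_minor0 (R : realType) G (Rg : nat -> {poly R}) n :
  casorati_minor G Rg n ord0 = OmegaG G Rg n%:R.
Proof.
rewrite /casorati_minor /cofactor expr0 mul1r; congr (\det _).
by apply/matrixP => a b; rewrite !mxE.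
Qed.

(** The leading coefficient Omega_G(n) never vanishes, so the difference equation
    determines each term from the [size G] preceding ones. *)
Lemma casorati_kernel_sequence (R : realType) G (Rg : nat -> {poly R}) (w : nat -> R) N :
  (forall n, OmegaG G Rg n%:R <> 0) -> (size G <= N)%N ->
  (forall n, (N <= n)%N ->
     \sum_(j < (size G).+1) casorati_minor G Rg n j * w (n - j)%N = 0) ->
  (forall k, (N - size G <= k < N)%N -> w k = 0) ->
  forall k, (N - size G <= k)%N -> w k = 0.
Proof.
move=> Om GN W w0 k; elim/ltn_ind: k => k IHk lo.
have [kN|Nk] := ltnP k N; first by rewrite w0 ?lo.
have := W k Nk; rewrite big_ord_recl subn0 casorati_minor0 big1 => [|j _].
  by rewrite addr0 => /eqP; rewrite mulf_eq0 => /orP[/eqP/Om|/eqP].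
by rewrite IHk ?mulr0 //= /bump /=; have := ltn_ord j; lia.
Qed.

Lemma poly_eventually0 (R : numDomainType) (p : {poly R}) (K : nat) :
  (forall k, (K <= k)%N -> p.[k%:R] = 0) -> p = 0.
Proof.
move=> p0; apply/eqP/negPn/negP => pn0.
have := @max_poly_roots _ p [seq k%:R | k <- iota K (size p)] pn0.
rewrite size_map size_iota ltnn => F; suff : false by []; apply: F.
  by apply/allP => _ /mapP[k + ->]; rewrite mem_iota => /andP[Kk _]; apply/rootP/p0.
by rewrite map_inj_uniq ?iota_uniq //; apply: mulrIn; rewrite oner_eq0.
Qed.

(** A nonvanishing Omega_G(N) allows the values of [z] at the [size G] integers
    below [N] to be matched by a combination of the family; the difference then
    satisfies the equation with zero initial values, hence vanishes at infinitely
    many integers. *)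
Lemma casorati_kernel_poly (R : realType) G (Rg : nat -> {poly R}) (z : {poly R}) N :
  (forall n, OmegaG G Rg n%:R <> 0) -> (size G <= N)%N ->
  (forall n, (N <= n)%N ->
     \sum_(j < (size G).+1) casorati_minor G Rg n j * z.[n%:R - j%:R] = 0) ->
  exists c : 'I_(size G) -> R, z = \sum_(l < size G) c l *: Rg (nth 0%N G l).
Proof.
move=> Om GN Z.
pose M := \matrix_(l < size G, j < size G) (Rg (nth 0%N G l)).[N%:R - j.+1%:R].
have Mu : M \in unitmx by rewrite unitmxE unitfE; apply/eqP/Om.
pose c := (\row_(j < size G) z.[N%:R - j.+1%:R]) *m invmx M.
exists (fun l => c ord0 l); apply/eqP; rewrite -subr_eq0; apply/eqP.
pose s : {poly R} := \sum_(l < size G) c ord0 l *: Rg (nth 0%N G l).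
have sE x : s.[x] = \sum_(l < size G) c ord0 l * (Rg (nth 0%N G l)).[x].
  by rewrite horner_sum; apply: eq_bigr => l _; rewrite hornerZ.
apply: (@poly_eventually0 _ (z - s) (N - size G)).
apply: (casorati_kernel_sequence Om GN) => [n Nn|k /andP[k1 k2]].
  have hE (j : 'I_(size G).+1) : (n - j)%:R = n%:R - j%:R :> R.
    by rewrite natrB //; have := ltn_ord j; lia.
  under eq_bigr => j _ do rewrite hE hornerD hornerN mulrBr.
  rewrite big_split /= Z // add0r sumrN; apply/eqP; rewrite oppr_eq0; apply/eqP.
  under eq_bigr => j _ do rewrite sE mulr_sumr.
  rewrite exchange_big big1 // => l _.
  under eq_bigr => j _ do rewrite mulrCA.
  by rewrite -mulr_sumr casorati_minor_annihilates ?mulr0 ?mem_nth.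
have jG : (N - k.+1 < size G)%N by lia.
have kE : k%:R = N%:R - (Ordinal jG).+1%:R :> R by rewrite -natrB /=; [congr _%:R|]; lia.
have /rowP/(_ (Ordinal jG)) : c *m M = \row_(j < size G) z.[N%:R - j.+1%:R].
  by rewrite mulmxKV.
rewrite !mxE -kE hornerD hornerN sE => <-; apply/eqP.
rewrite subr_eq0; apply/eqP; apply: eq_bigr => l _.
by rewrite !mxE -kE.
Qed.

(** As the degrees are pairwise distinct, no cancellation can occur at the largest
    index with a nonzero coefficient. *)
Lemma staircase_sum_eq0 (R : idomainType) (G : seq nat) (Rg : nat -> {poly R})
    (c : 'I_(size G) -> R) (d : nat) :
  sorted ltn G -> (forall g, g \in G -> size (Rg g) = g.+1) ->
  (forall g, g \in G -> (d <= g)%N) ->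
  (size (\sum_(l < size G) c l *: Rg (nth 0%N G l))%R <= d)%N ->
  \sum_(l < size G) c l *: Rg (nth 0%N G l) = 0.
Proof.
move=> sG sR dG small.
have [/existsP[l0 cl0]|] := boolP [exists l, c l != 0]; last first.
  rewrite negb_exists => /forallP c0; apply: big1 => l _.
  by have /negPn/eqP -> := c0 l; rewrite scale0r.
case: (@arg_maxnP _ l0 (fun l => c l != 0) val cl0) => l cl lmax.
have gl : nth 0%N G l \in G by rewrite mem_nth.
suff /eqP : c l * (Rg (nth 0%N G l))`_(nth 0%N G l) = 0.
  rewrite mulf_eq0 (negPf cl) /= -[X in _`_X]/(_.+1.-1) -(sR _ gl) -lead_coefE.
  by rewrite lead_coef_eq0 -size_poly_eq0 sR.
have /leq_sizeP/(_ _ (dG _ gl)) := small.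
rewrite coef_sum (bigD1 l) //= coefZ big1 ?addr0 // => l' nl'.
rewrite coefZ; have [->|cl'] := eqVneq (c l') 0; first by rewrite mul0r.
have ll' : (l' < l)%N by rewrite ltn_neqAle nl'; exact: lmax.
rewrite nth_default ?mulr0 // sR ?mem_nth //.
by apply: (sorted_ltn_nth ltn_trans 0%N sG); rewrite ?inE ?ltn_ord.
Qed.

(** * The Laguerre operator preserves the span of the family *)

(** The functional sending L_k to (Rg g)(k) is evaluated on 'X * q_n in two
    ways.  By the recurrence it gives a combination of its values at q_{n+1}, q_n
    and q_{n-1}, which are Casorati determinants with a repeated row; the strict
    bound on [n] makes this true also of q_{n-1}.  By the recurrence of the
    Laguerre polynomials it gives the left-hand side of the conclusion. *)
Lemma recurrence_casorati_dual (R : realType) (alpha : R) G (Rg : nat -> {poly R})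
    (a b c : nat -> R) g n :
  three_term_recurrence (laguerre_casorati alpha G Rg) a b c ->
  g \in G -> (size G < n)%N ->
  \sum_(j < (size G).+1)
    casorati_minor G Rg n j * (laguerre_dual alpha (Rg g)).[n%:R - j%:R] = 0.
Proof.
move=> rec gG Gn.
have [f fL] := graded_dual (fun k => (Rg g).[k%:R]) (size_laguerre alpha) n.+2.
have fq k : (size G <= k)%N -> (k <= n.+1)%N -> f (laguerre_casorati alpha G Rg k) = 0.
  move=> Gk kn; rewrite laguerre_casorati_sum linear_sum.
  rewrite -[RHS](casorati_minor_annihilates Rg k gG); apply: eq_bigr => j _.
  have jk : (j <= k)%N by have := ltn_ord j; lia.
  by rewrite linearZ /= subzn // fL ?natrB //; lia.
transitivity (f ('X * laguerre_casorati alpha G Rg n)); last first.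
  case: n Gn fL fq => // n Gn fL fq; rewrite rec !linearD !linearZ /=.
  by rewrite !fq ?mulr0 ?addr0 //; lia.
rewrite laguerre_casorati_sum mulr_sumr linear_sum; apply: eq_bigr => j _.
rewrite -scalerAr linearZ /=; congr (_ * _).
have jn : (j <= n)%N by have := ltn_ord j; lia.
rewrite subzn // -natrB //.
have : (0 < n - j)%N by have := ltn_ord j; lia.
case E: (n - j)%N => [//|t] _.
rewrite laguerre_recurrence ![f (_ + _)]linearD [f (- _)]linearN.
rewrite ![f (_ *: _)]linearZ /= !fL; [|lia..].
rewrite laguerre_dual_eval.
have -> : t%:R = t.+1%:R - 1 :> R by rewrite -[t.+1]addn1 natrD addrK.
by rewrite natr1.
Qed.

(** The smallest [g] in [G] produces a nonzero element of the span of degree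
    [g.-1], smaller than all the degrees available there. *)
Theorem laguerre_casorati_no_recurrence (R : realType) (alpha : R) (G : seq nat)
    (Rg : nat -> {poly R}) :
  sorted ltn G -> (0 < size G)%N -> (forall g, g \in G -> (0 < g)%N) ->
  (forall g, g \in G -> size (Rg g) = g.+1) ->
  (forall g, g \in G -> alpha <> g%:R) ->
  (forall n : nat, OmegaG G Rg n%:R <> 0) ->
  ~ exists a b c : nat -> R,
      three_term_recurrence (laguerre_casorati alpha G Rg) a b c.
Proof.
move=> G_sorted G_nonempty G_pos Rg_deg alphaG Om [a [b [c rec]]].
pose g := nth 0%N G 0; have gG : g \in G by rewrite mem_nth.
have gmin h : h \in G -> (g <= h)%N.
  move=> /(nthP 0%N)[i iG <-]; have [->//|i0] := posnP i.
  by apply: ltnW; apply: (sorted_ltn_nth ltn_trans 0%N G_sorted); rewrite ?inE.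
have [e gE] : exists e, g = e.+1 by exists g.-1; rewrite prednK ?G_pos.
have [sz cz] : (size (laguerre_dual alpha (Rg g)) <= g)%N /\
    (laguerre_dual alpha (Rg g))`_e = g%:R * (alpha - g%:R) * (Rg g)`_g.
  by have := @laguerre_dual_top _ alpha (Rg g) e; rewrite -gE; apply; rewrite Rg_deg.
have [k zE] := casorati_kernel_poly Om (leqnSn _)
  (fun n => @recurrence_casorati_dual _ _ _ _ a b c g n rec gG).
have z0 : laguerre_dual alpha (Rg g) = 0.
  by rewrite zE (staircase_sum_eq0 (d := g)) // -zE.
move/eqP: cz; rewrite z0 coef0 eq_sym !mulf_eq0 subr_eq0 => /orP[/orP[]|].
- by rewrite pnatr_eq0 gE.
- by move/eqP; apply: alphaG.
rewrite -[X in _`_X]/(g.+1.-1) -(Rg_deg _ gG) -lead_coefE lead_coef_eq0.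
by rewrite -size_poly_eq0 Rg_deg.
Qed.

(** * From orthogonality to the three-term recurrence *)

(** The top coefficient of q_n is Omega_G(n) times that of L_n, the other terms of
    the expansion having smaller degree. *)
Lemma size_laguerre_casorati (R : realType) (alpha : R) G (Rg : nat -> {poly R}) n :
  OmegaG G Rg n%:R <> 0 -> size (laguerre_casorati alpha G Rg n) = n.+1.
Proof.
move=> Om; rewrite laguerre_casorati_sum big_ord_recl subr0 casorati_minor0.
rewrite size_polyDl size_scale ?size_laguerre //; try exact/eqP.
rewrite ltnS; apply: (leq_trans (size_sum _ _ _)); apply/bigmax_leqP => j _.
apply: (leq_trans (size_scale_leq _ _)).
case E: (n%:Z - _) => [k|k] /=; last by rewrite size_poly0.
by rewrite size_laguerre; move: E; rewrite /= /bump /=; lia.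
Qed.

Lemma orthogonal_lower (F : fieldType) (U : {scalar {poly F}}) (q : nat -> {poly F})
    (p : {poly F}) (k : nat) :
  (forall n, size (q n) = n.+1) ->
  (forall n k, n <> k -> U (q n * q k) = 0) ->
  (size p <= k)%N -> U (p * q k) = 0.
Proof.
move=> size_q U_orth sp.
apply: (graded_ind (P := fun n p => forall k, (n <= k)%N -> U (p * q k) = 0)
  size_q _ _ sp k (leqnn k)) => [j _|n r c IH j nj]; first by rewrite mul0r linear0.
rewrite mulrDl -scalerAl linearD linearZ /= IH ?(ltnW nj) //.
by rewrite U_orth ?mulr0 ?addr0 //; lia.
Qed.

Lemma orthogonal_all_eq0 (F : fieldType) (U : {scalar {poly F}}) (q : nat -> {poly F})
    (p : {poly F}) :
  (forall n, size (q n) = n.+1) ->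
  (forall n k, n <> k -> U (q n * q k) = 0) ->
  (forall n, U (q n * q n) != 0) ->
  (forall k, U (p * q k) = 0) -> p = 0.
Proof.
move=> size_q U_orth U_norm Up; apply/eqP; rewrite -size_poly_eq0; case sp: (size p) => [//|n].
have s' := size_split_top (size_q n) (eq_leq sp).
have := orthogonal_lower size_q U_orth s'.
rewrite mulrBl -scalerAl linearB linearZ /= Up sub0r => /eqP.
rewrite oppr_eq0 mulf_eq0 (negPf (U_norm n)) orbF => /eqP c0.
by move: s'; rewrite c0 scale0r subr0 sp ltnn.
Qed.

(** The coefficients are the Fourier coefficients of 'X * q_n; those at indices
    other than n-1, n and n+1 vanish by degree, because 'X can be moved from one
    factor to the other. *)
Lemma orthogonal_three_term (F : fieldType) (U : {scalar {poly F}}) (q : nat -> {poly F}) :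
  (forall n, size (q n) = n.+1) ->
  (forall n k, n <> k -> U (q n * q k) = 0) ->
  (forall n, U (q n * q n) != 0) ->
  exists a b c : nat -> F, forall n,
    'X * q n = a n *: q n.+1 + b n *: q n + c n *: (if n is k.+1 then q k else 0).
Proof.
move=> size_q U_orth U_norm; pose t n k := U ('X * q n * q k) / U (q k * q k).
exists (fun n => t n n.+1), (fun n => t n n), (fun n => t n n.-1) => n.
apply/eqP; rewrite -subr_eq0; apply/eqP; apply: (orthogonal_all_eq0 size_q U_orth U_norm) => k.
rewrite mulrBl !mulrDl -!scalerAl linearB !linearD !linearZ /=.
have tE j : t n j * U (q j * q j) = U ('X * q n * q j) by rewrite divfK.
have low j : (j.+1 < n)%N -> U ('X * q n * q j) = 0.
  move=> jn; rewrite mulrAC; apply: (orthogonal_lower size_q U_orth).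
  by rewrite -[X in (X <= _)%N]/(size _) mulrC size_mulX -?size_poly_eq0 size_q.
have high : (n.+1 < k)%N -> U ('X * q n * q k) = 0.
  move=> nk; apply: (orthogonal_lower size_q U_orth).
  by rewrite mulrC size_mulX -?size_poly_eq0 size_q.
have [->|nk1] := eqVneq k n.+1.
  rewrite tE (U_orth n) ?mulr0 ?addr0; last by lia.
  by case: (n) => [|m]; rewrite ?mul0r ?linear0 ?U_orth ?mulr0 ?addr0 ?subrr //; lia.
have Uk1 : U (q n.+1 * q k) = 0 by apply: U_orth; apply/eqP; rewrite eq_sym.
rewrite Uk1 mulr0 add0r.
have [->|nk] := eqVneq k n.
  rewrite tE.
  by case: (n) => [|m]; rewrite ?mul0r ?linear0 ?U_orth ?mulr0 ?addr0 ?subrr //; lia.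
have Uk : U (q n * q k) = 0 by apply: U_orth; apply/eqP; rewrite eq_sym.
rewrite Uk mulr0 add0r.
case: n nk1 nk {Uk1 Uk} tE low high => [|m] nk1 nk tE low high.
  by rewrite mul0r linear0 mulr0 subr0 high //; lia.
have [->|mk] := eqVneq k m; first by rewrite tE subrr.
rewrite (U_orth m) ?mulr0 ?subr0; last by apply/eqP; rewrite eq_sym.
by have [?|?] := ltnP m.+2 k; [apply: high|apply: low; lia].
Qed.

Lemma charge_integrable_linear (R : realType)
    (nu : {charge set (measurableTypeR R) -> \bar R})
    (P N : set (measurableTypeR R)) (nuPN : hahn_decomposition nu P N)
    (a : R) (f g : R -> R) :
  charge_integrable nuPN f -> charge_integrable nuPN g ->
  charge_integrable nuPN (fun x => a * f x + g x).
Proof.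
move=> [f1 f2] [g1 g2]; split.
  exact: (integrableD measurableT (integrableZl measurableT a f1) g1).
exact: (integrableD measurableT (integrableZl measurableT a f2) g2).
Qed.

Lemma charge_integral_linear (R : realType)
    (nu : {charge set (measurableTypeR R) -> \bar R})
    (P N : set (measurableTypeR R)) (nuPN : hahn_decomposition nu P N)
    (a : R) (f g : R -> R) :
  charge_integrable nuPN f -> charge_integrable nuPN g ->
  charge_integral nuPN (fun x => a * f x + g x) =
  a * charge_integral nuPN f + charge_integral nuPN g.
Proof.
move=> [f1 f2] [g1 g2]; rewrite /charge_integral.
have z1 := integrableZl measurableT a f1; have z2 := integrableZl measurableT a f2.
by rewrite !RintegralD // !RintegralZl //; ring.
Qed.

(** Integrability of all polynomials follows from that of the products q_n q_k,
    because q_0 is a nonzero constant and the q_n form a basis. *)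
Lemma charge_functional (R : realType)
    (nu : {charge set (measurableTypeR R) -> \bar R})
    (P N : set (measurableTypeR R)) (nuPN : hahn_decomposition nu P N)
    (q : nat -> {poly R}) :
  (forall n, size (q n) = n.+1) ->
  (forall n k, charge_integrable nuPN (fun x => (q n).[x] * (q k).[x])) ->
  exists U : {scalar {poly R}}, forall p, U p = charge_integral nuPN (fun x => p.[x]).
Proof.
move=> sq qI.
have [c c0 q0E] : exists2 c, c != 0 & q 0%N = c%:P.
  have /size_poly1P[c c0 E] : size (q 0%N) == 1%N by rewrite sq.
  by exists c.
have pI p : charge_integrable nuPN (fun x => p.[x]).
  have z : charge_integrable nuPN (fun x => (0 : R)).
    by split; exact: integrable0.
  apply: (graded_ind (P := fun _ p => charge_integrable nuPN (fun x => p.[x])) sq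
    _ _ (leqnn (size p))) => [|n r b rI].
    by under eq_fun do rewrite horner0.
  have -> : (fun x => (r + b *: q n).[x]) =
      (fun x => (b / c) * ((q n).[x] * (q 0%N).[x]) + r.[x]).
    by apply/funext => x; rewrite q0E !hornerE /=; field.
  exact: charge_integrable_linear.
pose u (p : {poly R}) : R := charge_integral nuPN (fun x => p.[x]).
have u_lin : linear_for *%R u.
  move=> a p r; rewrite /u -charge_integral_linear //.
  by under eq_fun do rewrite hornerD hornerZ.
pose ul := GRing.isLinear.Build R {poly R} R *%R u u_lin.
by exists (HB.pack_for {scalar {poly R}} u ul).
Qed.

Theorem corollary4p3 (R : realType) (alpha : R) (G : seq nat)
    (Rg : nat -> {poly R})
    (G_sorted : sorted ltn G)
    (G_nonempty : (0 < size G)%N)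
    (G_pos : forall g : nat, g \in G -> (0 < g)%N)
    (Rg_deg : forall g : nat, g \in G -> size (Rg g) = g.+1)
    (Rg_lead : forall g : nat, g \in G -> lead_coef (Rg g) = (g`!%:R)^-1)
    (alpha_maxG : forall k : nat, alpha - (\max_(g <- G) g)%:R <> - k%:R)
    (Omega_neq0 : forall n : nat, OmegaG G Rg n%:R <> 0) :
  (~ exists a b c : nat -> R,
       (forall n : nat, (1 <= n)%N -> c n <> 0) /\
       three_term_recurrence (laguerre_casorati alpha G Rg) a b c)
  /\
  (~ exists nu : {charge set (measurableTypeR R) -> \bar R},
       orthogonal_wrt (laguerre_casorati alpha G Rg) nu).
Proof.
have alphaG g : g \in G -> alpha <> g%:R.
  move=> gG alphaE; apply: (alpha_maxG (\max_(h <- G) h - g)%N).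
  by rewrite natrB ?opprB ?alphaE // (leq_bigmax_seq g gG).
have no_rec := laguerre_casorati_no_recurrence
  G_sorted G_nonempty G_pos Rg_deg alphaG Omega_neq0.
split=> [[a [b [c [_ rec]]]]|[nu [P [N [nuPN [qI q_orth q_norm]]]]]].
  by apply: no_rec; exists a, b, c.
have sq n := size_laguerre_casorati alpha (Omega_neq0 n).
have [U UE] := charge_functional sq qI.
apply/no_rec/(orthogonal_three_term (U := U) sq) => [n k nk|n].
  by rewrite UE -(q_orth n k nk); under eq_fun do rewrite hornerM.
by rewrite UE; apply/eqP; under eq_fun do rewrite hornerM -expr2; exact: q_norm.
Qed.
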